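(* Let $\psi\in\mathcal C$, let $F_1,F_2:\mathbb R\to(0,\infty)$ be measurable and let $h\in\Phi\cup\Psi$. Then for every $T\in SL_{\pm}(n)$, $$as^{orlicz}_{h,F_1,F_2}(\psi\circ T)=as^{orlicz}_{h,F_1,F_2}(\psi)\quad\text{and}\quad G^{orlicz}_{h,F_1,F_2}(\psi\circ T)=G^{orlicz}_{h,F_1,F_2}(\psi).$$ In particular, for $f=e^{-\psi}$, $as^{orlicz}_h(f)$ and $G^{orlicz}_h(f)$ are $SL_{\pm}(n)$-invariant.
   Context: $\mathcal C$ is the set of convex functions $\psi:\mathbb R^n\to\mathbb R\cup\{+\infty\}$ whose domain has nonempty interior; $\psi^*(y)=\sup_x(\langle x,y\rangle-\psi(x))$; $\nabla^2\psi$ is the Alexandrov Hessian; $X_\psi=\{x:\psi(x)<\infty,\ \nabla^2\psi(x)\text{ exists and is invertible}\}$. $I(g,\psi^* )=\int_{X_{\psi^*}}g$; $\mathcal F^+_{\psi^*}$ is the set of integrable $g>0$ on $X_{\psi^*}$ with $0<I(g,\psi^* )<\infty$; $\mathcal L_{\psi^*}$ is the subset of log-concave members of $\mathcal F^+_{\psi^*}$. For continuous $h:(0,\infty)\to(0,\infty)$, $V_{h,F_1,F_2}(\psi,g)=\int_{X_\psi}h\big(\frac{g(\nabla\psi(x))}{F_2(\langle x,\nabla\psi(x)\rangle-\psi(x))}\big)F_1(\psi(x))dx$. $\Phi$ is the set of $h$ that are constant or strictly convex; $\Psi$ is the set of $h$ that are constant or increasing and strictly concave. For $h\in\Phi$: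 $$as^{orlicz}_{h,F_1,F_2}(\psi)=\inf_{g\in\mathcal F^+_{\psi^*}}V_{h,F_1,F_2}\Big(\psi,\tfrac{(\sqrt{2\pi})^n g}{I(g,\psi^* )}\Big),\qquad G^{orlicz}_{h,F_1,F_2}(\psi)=\inf_{g\in\mathcal L_{\psi^*}}V_{h,F_1,F_2}\Big(\psi,\tfrac{(\sqrt{2\pi})^n g}{I(g,\psi^* )}\Big);$$ for $h\in\Psi$ the same with $\inf$ replaced by $\sup$. For $f=e^{-\psi}$: $as^{orlicz}_h(f)=as^{orlicz}_{h,e^{-t},e^{-t}}(\psi)$ and $G^{orlicz}_h(f)=G^{orlicz}_{h,e^{-t},e^{-t}}(\psi)$. $SL_{\pm}(n)$ is the set of linear maps with determinant $\pm1$, $(\psi\circ T)(x)=\psi(Tx)$, and for $f=e^{-\psi}$ invariance means $as^{orlicz}_h(f\circ T)=as^{orlicz}_h(f)$ etc. Standing assumption: all integrals are well defined. *)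

(* Defs.v *)
From HB Require Import structures.
From mathcomp Require Import all_boot all_order all_algebra.
From mathcomp Require Import all_classical all_reals all_analysis.
Set Implicit Arguments.
Unset Strict Implicit.
Unset Printing Implicit Defensive.
Import Order.TTheory GRing.Theory Num.Theory.
Import numFieldNormedType.Exports.
Local Open Scope classical_set_scope.
Local Open Scope ring_scope.

Definition dotv (R : realType) (n : nat) (x y : 'cV[R]_n) : R :=
  \sum_(i < n) x i 0 * y i 0.

Definition enorm (R : realType) (n : nat) (x : 'cV[R]_n) : R :=
  Num.sqrt (dotv x x).

Definition box (R : realType) (n : nat) (a b : 'cV[R]_n) : set 'cV[R]_n :=
  [set x | forall i : 'I_n, a i 0 <= x i 0 <= b i 0].

Definition box_vol (R : realType) (n : nat) (a b : 'cV[R]_n) : R :=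
  \prod_(i < n) Num.max (b i 0 - a i 0) 0.

Definition lebesgue_outer (R : realType) (n : nat) (A : set 'cV[R]_n) : \bar R :=
  ereal_inf [set (\sum_(k <oo) (box_vol (B k).1 (B k).2)%:E)%E
            | B in [set B : nat -> 'cV[R]_n * 'cV[R]_n |
                     A `<=` \bigcup_k box (B k).1 (B k).2]].

Definition lebesgue_measurable_set (R : realType) (n : nat) (A : set 'cV[R]_n) :=
  forall B : set 'cV[R]_n,
    lebesgue_outer B = (lebesgue_outer (B `&` A) + lebesgue_outer (B `&` ~` A))%E.

Definition lebesgue_measurable_fun (R : realType) (n : nat)
    (D : set 'cV[R]_n) (f : 'cV[R]_n -> R) :=
  forall t : R, lebesgue_measurable_set (D `&` [set x | t < f x]).

(* Lebesgue integral over D of a nonnegative function (layer-cake formula,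
   the outer integral being the 1-dimensional Lebesgue integral) *)
Definition integral_nonneg (R : realType) (n : nat)
    (D : set 'cV[R]_n) (f : 'cV[R]_n -> R) : \bar R :=
  (\int[@lebesgue_measure R]_(t in [set t : R | (0 < t)%R])
      lebesgue_outer (D `&` [set x | (t < f x)%R]))%E.

Definition integral_Rn (R : realType) (n : nat)
    (D : set 'cV[R]_n) (f : 'cV[R]_n -> R) : \bar R :=
  (integral_nonneg D (fun x => Num.max (f x) 0)%R
   - integral_nonneg D (fun x => Num.max (- f x) 0)%R)%E.

Definition econvex (R : realType) (n : nat) (psi : 'cV[R]_n -> \bar R) :=
  forall (x y : 'cV[R]_n) (t : R), 0 < t < 1 ->
    (psi ((1 - t) *: x + t *: y)%R <= (1 - t)%:E * psi x + t%:E * psi y)%E.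

Definition class_C (R : realType) (n : nat) (psi : 'cV[R]_n -> \bar R) :=
  [/\ (forall x, psi x != -oo%E), econvex psi &
      exists (x : 'cV[R]_n) (r : R), 0 < r /\
        forall y, enorm (y - x) < r -> (psi y < +oo)%E].

Definition legendre (R : realType) (n : nat) (psi : 'cV[R]_n -> \bar R)
    (y : 'cV[R]_n) : \bar R :=
  ereal_sup [set ((dotv x y)%:E - psi x)%E | x in [set: 'cV[R]_n]].

Definition finite_near (R : realType) (n : nat) (psi : 'cV[R]_n -> \bar R)
    (x : 'cV[R]_n) :=
  exists r : R, 0 < r /\ forall y, enorm (y - x) < r -> psi y \is a fin_num.

Definition has_gradient (R : realType) (n : nat) (psi : 'cV[R]_n -> \bar R)
    (x v : 'cV[R]_n) :=
  finite_near psi x /\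
  forall e : R, 0 < e -> exists d : R, 0 < d /\ forall y, enorm (y - x) < d ->
    `|fine (psi y) - fine (psi x) - dotv v (y - x)| <= e * enorm (y - x).

(* the gradient (where it exists; junk value 0 elsewhere) *)
Definition grad (R : realType) (n : nat) (psi : 'cV[R]_n -> \bar R)
    (x : 'cV[R]_n) : 'cV[R]_n :=
  xget 0 [set v | has_gradient psi x v].

Definition alexandrov_taylor (R : realType) (n : nat) (psi : 'cV[R]_n -> \bar R)
    (x v : 'cV[R]_n) (A : 'M[R]_n) :=
  finite_near psi x /\
  forall e : R, 0 < e -> exists d : R, 0 < d /\ forall y, enorm (y - x) < d ->
    `|fine (psi y) - fine (psi x) - dotv v (y - x)
       - 2^-1 * dotv (A *m (y - x)) (y - x)| <= e * enorm (y - x) ^+ 2.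

Definition alexandrov_hessian (R : realType) (n : nat) (psi : 'cV[R]_n -> \bar R)
    (x : 'cV[R]_n) (A : 'M[R]_n) :=
  A^T = A /\ exists v, alexandrov_taylor psi x v A.

Definition Xset (R : realType) (n : nat) (psi : 'cV[R]_n -> \bar R) : set 'cV[R]_n :=
  [set x | (psi x < +oo)%E /\ exists A, alexandrov_hessian psi x A /\ A \in unitmx].

Definition Iint (R : realType) (n : nat) (g : 'cV[R]_n -> R)
    (psi : 'cV[R]_n -> \bar R) : \bar R :=
  integral_Rn (Xset (legendre psi)) g.

Definition Fplus (R : realType) (n : nat) (psi : 'cV[R]_n -> \bar R)
    : set ('cV[R]_n -> R) :=
  [set g | [/\ lebesgue_measurable_fun (Xset (legendre psi)) g,
              (forall y, Xset (legendre psi) y -> 0 < g y) &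
              (0 < Iint g psi < +oo)%E]].

Definition Lplus (R : realType) (n : nat) (psi : 'cV[R]_n -> \bar R)
    : set ('cV[R]_n -> R) :=
  [set g | Fplus psi g /\
     exists phi : 'cV[R]_n -> \bar R,
       [/\ (forall x, phi x != -oo%E), econvex phi &
           forall y, Xset (legendre psi) y -> (g y)%:E = expeR (- phi y)%E]].

Definition Vfun (R : realType) (n : nat) (h F1 F2 : R -> R)
    (psi : 'cV[R]_n -> \bar R) (g : 'cV[R]_n -> R) : \bar R :=
  integral_Rn (Xset psi) (fun x =>
    h (g (grad psi x) / F2 (dotv x (grad psi x) - fine (psi x)))
    * F1 (fine (psi x))).

Definition normalize (R : realType) (n : nat) (psi : 'cV[R]_n -> \bar R)
    (g : 'cV[R]_n -> R) : 'cV[R]_n -> R :=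
  fun y => (Num.sqrt (2 * pi)) ^+ n * g y / fine (Iint g psi).

(* as^{orlicz} and G^{orlicz}: inf version (h in Phi) and sup version (h in Psi) *)
Definition as_orlicz_inf (R : realType) (n : nat) (h F1 F2 : R -> R)
    (psi : 'cV[R]_n -> \bar R) : \bar R :=
  ereal_inf [set Vfun h F1 F2 psi (normalize psi g) | g in Fplus psi].
Definition as_orlicz_sup (R : realType) (n : nat) (h F1 F2 : R -> R)
    (psi : 'cV[R]_n -> \bar R) : \bar R :=
  ereal_sup [set Vfun h F1 F2 psi (normalize psi g) | g in Fplus psi].
Definition G_orlicz_inf (R : realType) (n : nat) (h F1 F2 : R -> R)
    (psi : 'cV[R]_n -> \bar R) : \bar R :=
  ereal_inf [set Vfun h F1 F2 psi (normalize psi g) | g in Lplus psi].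
Definition G_orlicz_sup (R : realType) (n : nat) (h F1 F2 : R -> R)
    (psi : 'cV[R]_n -> \bar R) : \bar R :=
  ereal_sup [set Vfun h F1 F2 psi (normalize psi g) | g in Lplus psi].

(* ---------- the classes of h (h only matters on (0,oo)) ---------- *)
Definition pos_continuous (R : realType) (h : R -> R) :=
  forall x : R, 0 < x -> 0 < h x /\ {for x, continuous h}.

Definition constant_pos (R : realType) (h : R -> R) :=
  exists c : R, forall x, 0 < x -> h x = c.

Definition strictly_convex_pos (R : realType) (h : R -> R) :=
  forall x y t : R, 0 < x -> 0 < y -> x != y -> 0 < t < 1 ->
    h ((1 - t) * x + t * y) < (1 - t) * h x + t * h y.

Definition strictly_concave_pos (R : realType) (h : R -> R) :=
  forall x y t : R, 0 < x -> 0 < y -> x != y -> 0 < t < 1 ->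
    (1 - t) * h x + t * h y < h ((1 - t) * x + t * y).

Definition increasing_pos (R : realType) (h : R -> R) :=
  forall x y : R, 0 < x -> x < y -> h x < h y.

Definition PhiClass (R : realType) (h : R -> R) :=
  constant_pos h \/ strictly_convex_pos h.

Definition PsiClass (R : realType) (h : R -> R) :=
  constant_pos h \/ (increasing_pos h /\ strictly_concave_pos h).

Definition compT (R : realType) (n : nat) (psi : 'cV[R]_n -> \bar R)
    (T : 'M[R]_n) : 'cV[R]_n -> \bar R :=
  fun x => psi (T *m x).

Definition expneg (R : realType) (t : R) : R := expR (- t).

(* Main.v *)
Require Import Defs.
From HB Require Import structures.
From mathcomp Require Import all_boot all_order all_fingroup all_algebra.
From mathcomp Require Import all_classical all_reals all_analysis.
From mathcomp Require Import ring lra.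
Import Order.TTheory GRing.Theory Num.Theory.
Local Open Scope classical_set_scope.
Local Open Scope ring_scope.

(** The transposed inverse of T carries the conjugate of psi to the conjugate
    of psi o T and T^T carries the gradient of psi at T x to that of psi o T at
    x, so g |-> g o T^-T maps the densities admissible for psi to those
    admissible for psi o T without changing the functional V, provided that the
    Lebesgue outer measure is invariant under matrices of determinant 1 or -1.
    Covering by boxes, a permutation or a diagonal matrix of determinant 1 or
    -1 preserves the volume of boxes, and a transvection does so up to an
    arbitrarily small error after cutting the box into thin slabs; an LUP
    decomposition writes every matrix of determinant 1 or -1 as a product of
    these. *)

(** * Lebesgue outer measure: monotonicity and countable subadditivity *)

Section outer_measure.
Context {R : realType} {n : nat}.
Implicit Types (A : set 'cV[R]_n) (a b : 'cV[R]_n).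

Lemma box_vol_ge0 a b : 0 <= box_vol a b.
Proof. by apply: prodr_ge0 => i _; rewrite le_max lexx orbT. Qed.

Lemma box_volE a b : (forall i, a i 0 <= b i 0) ->
  box_vol a b = \prod_i (b i 0 - a i 0).
Proof. by move=> ab; apply: eq_bigr => i _; rewrite max_l// subr_ge0. Qed.

Lemma lebesgue_outer_ge0 A : (0 <= lebesgue_outer A)%E.
Proof.
apply: le_ereal_inf_tmp => _ [B _ <-].
by apply: nneseries_ge0 => k _ _; rewrite lee_fin box_vol_ge0.
Qed.

Lemma lebesgue_outer_cover A (B : nat -> 'cV[R]_n * 'cV[R]_n) :
  A `<=` \bigcup_k box (B k).1 (B k).2 ->
  (lebesgue_outer A <= \sum_(k <oo) (box_vol (B k).1 (B k).2)%:E)%E.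
Proof. by move=> AB; apply: ereal_inf_lbound; exists B. Qed.

Lemma le_lebesgue_outer A A' : A `<=` A' ->
  (lebesgue_outer A <= lebesgue_outer A')%E.
Proof.
move=> AA'; apply: le_ereal_inf_tmp => _ [B A'B <-].
by apply: lebesgue_outer_cover; apply: subset_trans A'B.
Qed.

(** If all terms are finite, cover the k-th set up to an error e / 2^(k+1), so that the errors sum
    to e. A bijection of [nat] with [nat * nat] turns the double family of boxes into one sequence,
    and nonnegativity allows the rearrangement of the series. *)
Lemma lebesgue_outer_sigma_subadditive (A : nat -> set 'cV[R]_n) :
  (lebesgue_outer (\bigcup_k A k) <= \sum_(k <oo) lebesgue_outer (A k))%E.
Proof.
have [[k Akoo]|Afin] := pselect (exists k, lebesgue_outer (A k) = +oo%E).
  rewrite (eseries_pinfty _ _ Akoo) ?leey// => i _.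
  by rewrite -ltNye (lt_le_trans _ (lebesgue_outer_ge0 _)).
apply/lee_addgt0Pr => e e0.
apply: le_trans (epsilon_trick _ _ (ltW e0)); last first.
  by move=> k; exact: lebesgue_outer_ge0.
have near_optimal k : exists B : nat -> 'cV[R]_n * 'cV[R]_n,
    A k `<=` \bigcup_m box (B m).1 (B m).2 /\
    (\sum_(m <oo) (box_vol (B m).1 (B m).2)%:E <=
       lebesgue_outer (A k) + (e / (2 ^ k.+1)%:R)%:E)%E.
  have ek0 : 0 < e / (2 ^ k.+1)%:R by rewrite divr_gt0// ltr0n expn_gt0.
  have Afink : lebesgue_outer (A k) \is a fin_num.
    rewrite ge0_fin_numE ?lebesgue_outer_ge0// ltey.
    by apply/eqP => Akoo; apply: Afin; exists k.
  have [_ [B AB <-] ltB] := lb_ereal_inf_adherent ek0 Afink.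
  by exists B; split => //; exact: ltW.
have [B BP] := choice near_optimal.
pose vol (p : nat * nat) := (box_vol (B p.1 p.2).1 (B p.1 p.2).2)%:E.
have vol0 p : (0 <= vol p)%E by rewrite lee_fin box_vol_ge0.
have /card_esym/ppcard_eqP[f] := card_nat2.
apply: (@le_trans _ _ (\sum_(m <oo) vol (f m))%E).
  apply: (@lebesgue_outer_cover _ (fun m => B (f m).1 (f m).2)).
  move=> x [k _ /(proj1 (BP k))[m _ Bx]].
  by exists (f^-1%FUN (k, m)) => //=; rewrite invK ?inE.
rewrite nneseries_esumT//.
rewrite -(@reindex_esum _ _ _ setT setT f vol)//.
rewrite -[setT]setXTT.
have -> : (setT `*` setT)%classic =
    (setT `*`` (fun=> setT))%classic :> set (nat * nat) by [].
rewrite -(@esum_esum _ _ _ setT (fun=> setT) (fun i j => vol (i, j)))//.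
rewrite -nneseries_esumT; last by move=> k; exact: esum_ge0.
apply: lee_nneseries => [k _ _|k _]; first exact: esum_ge0.
by rewrite -nneseries_esumT//; exact: (proj2 (BP k)).
Qed.

End outer_measure.

(** * Elementary matrices that do not increase outer measure under preimage *)

Section linear_maps.
Context {R : realType}.

(** The finite family is padded with empty boxes of volume 0. This is where the dimension must be
    positive: in dimension 0 every volume is an empty product, hence 1. *)
Lemma lebesgue_outer_finite_cover {n} (A : set 'cV[R]_n.+1) N
    (B : nat -> 'cV[R]_n.+1 * 'cV[R]_n.+1) :
  A `<=` \bigcup_(k < N) box (B k).1 (B k).2 ->
  (lebesgue_outer A <= (\sum_(k < N) box_vol (B k).1 (B k).2)%:E)%E.
Proof.
pose empty_box : 'cV[R]_n.+1 * 'cV[R]_n.+1 := (const_mx 1, const_mx 0).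
pose C k := if (k < N)%N then B k else empty_box.
move=> AB; apply: (@le_trans _ _ (\sum_(k <oo) (box_vol (C k).1 (C k).2)%:E)%E).
  apply: lebesgue_outer_cover => x /AB[k /= kN Bkx]; exists k => //.
  by rewrite /C kN.
rewrite (@nneseries_split _ _ 0 N); last by move=> k _; rewrite lee_fin box_vol_ge0.
rewrite eseries0 => [|k Nk _]; last first.
  by rewrite /C ltnNge Nk /= /box_vol big_ord_recl !mxE sub0r max_r ?mul0r.
rewrite adde0 add0n sumEFin big_mkord lee_fin.
by apply: ler_sum => k _; rewrite /C ltn_ord.
Qed.

Lemma lebesgue_outer_box_le {n} (a b : 'cV[R]_n.+1) :
  (lebesgue_outer (box a b) <= (box_vol a b)%:E)%E.
Proof.
have := @lebesgue_outer_finite_cover n (box a b) 1 (fun=> (a, b)).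
by rewrite big_ord1; apply => x abx; exists 0%N.
Qed.

Lemma lebesgue_outer_set0 {n} : lebesgue_outer (set0 : set 'cV[R]_n.+1) = 0%E.
Proof.
apply/eqP; rewrite eq_le lebesgue_outer_ge0 andbT.
have := @lebesgue_outer_finite_cover n set0 0 (fun=> (0, 0)).
by rewrite big_ord0; apply.
Qed.

(** Only an inequality is asked for: it is stable under products, and applying it to the inverse
    matrix as well restores equality. *)
Definition outer_nonincreasing {n} (T : 'M[R]_n) :=
  forall A : set 'cV[R]_n,
    (lebesgue_outer [set x | A (T *m x)] <= lebesgue_outer A)%E.

(** By countable subadditivity it suffices to treat the boxes of a cover one by one. A box with some
    end out of order is empty, so ordered ends may be assumed. *)
Lemma outer_nonincreasing_box {n} (T : 'M[R]_n.+1) :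
  (forall a b : 'cV[R]_n.+1, (forall i, a i 0 <= b i 0) ->
     (lebesgue_outer [set x | box a b (T *m x)%R] <= (box_vol a b)%:E)%E) ->
  outer_nonincreasing T.
Proof.
move=> Tbox A; apply: le_ereal_inf_tmp => _ [B AB <-].
apply: (@le_trans _ _ (lebesgue_outer
    (\bigcup_k [set x | box (B k).1 (B k).2 (T *m x)%R]))).
  by apply: le_lebesgue_outer => x /AB[k _ Bk]; exists k.
apply: le_trans (lebesgue_outer_sigma_subadditive _) _.
apply: lee_nneseries => [k _ _|k _]; first exact: lebesgue_outer_ge0.
have [|nab] := pselect (forall i, (B k).1 i 0 <= (B k).2 i 0); first exact: Tbox.
rewrite (_ : [set x | _] = set0) ?lebesgue_outer_set0 ?lee_fin ?box_vol_ge0//.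
apply/seteqP; split => // x /= bx; apply: nab => i.
by have /andP[/le_trans] := bx i; apply.
Qed.

Lemma outer_nonincreasing_mul {n} (S T : 'M[R]_n) :
  outer_nonincreasing S -> outer_nonincreasing T -> outer_nonincreasing (S *m T).
Proof.
move=> Sdec Tdec A; apply: le_trans (Sdec A).
rewrite (_ : [set x | _] = [set x | [set y | A (S *m y)] (T *m x)]); first exact: Tdec.
by apply/seteqP; split => x /=; rewrite mulmxA.
Qed.

Lemma outer_nonincreasing1 {n} : outer_nonincreasing (1%:M : 'M[R]_n).
Proof.
by move=> A; apply: le_lebesgue_outer => x /=; rewrite mul1mx.
Qed.

Lemma outer_nonincreasing_dim0 (T : 'M[R]_0) : outer_nonincreasing T.
Proof.
rewrite (_ : T = 1%:M); first exact: outer_nonincreasing1.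
by apply/matrixP => -[].
Qed.

Lemma outer_nonincreasing_perm {n} (s : {perm 'I_n}) :
  outer_nonincreasing (perm_mx s : 'M[R]_n).
Proof.
case: n s => [|n] s.
  exact: outer_nonincreasing_dim0.
apply: outer_nonincreasing_box => a b ab.
(* The preimage is a box with permuted sides: coordinate i of x is coordinate s^-1 i of its
   image. *)
pose unperm (c : 'cV[R]_n.+1) : 'cV[R]_n.+1 := \col_i c ((s^-1)%g i) 0.
have -> : box_vol a b = box_vol (unperm a) (unperm b).
  rewrite [RHS](reindex_perm s)/=.
  by apply: eq_bigr => i _; rewrite !mxE permK.
apply: le_trans (lebesgue_outer_box_le _ _).
apply: le_lebesgue_outer => x /= bx i; rewrite !mxE.
have := bx ((s^-1)%g i).
by rewrite -row_permE mxE permKV.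
Qed.

Lemma outer_nonincreasing_diag {n} (d : 'rV[R]_n) :
  `|\det (diag_mx d)| = 1 -> outer_nonincreasing (diag_mx d).
Proof.
case: n d => [|n] d.
  by move=> _; exact: outer_nonincreasing_dim0.
rewrite det_diag normr_prod => d1; apply: outer_nonincreasing_box => a b ab.
have dn0 i : d 0 i != 0.
  apply/eqP => di0; move: d1; rewrite (bigD1 i)//= di0 normr0 mul0r => /esym/eqP.
  by rewrite oner_eq0.
(* The preimage is again a box, with i-th side divided by |d_i|; a negative entry swaps the two
   ends. *)
pose lo : 'cV[R]_n.+1 := \col_i (if 0 < d 0 i then a i 0 / d 0 i else b i 0 / d 0 i).
pose hi : 'cV[R]_n.+1 := \col_i (if 0 < d 0 i then b i 0 / d 0 i else a i 0 / d 0 i).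
have len i : hi i 0 - lo i 0 = (b i 0 - a i 0) / `|d 0 i|.
  rewrite !mxE; case: (ltrgtP 0 (d 0 i)) (dn0 i) => [dp|dm|<-] d0.
  - by rewrite gtr0_norm// mulrBl.
  - by rewrite ltr0_norm// invrN mulrN mulrBl opprB.
  - by [].
have lohi i : lo i 0 <= hi i 0.
  by rewrite -subr_ge0 len divr_ge0// subr_ge0.
have -> : box_vol a b = box_vol lo hi.
  rewrite !box_volE// (eq_bigr _ (fun i _ => len i)) big_split/= prodfV d1.
  by rewrite invr1 mulr1.
apply: le_trans (lebesgue_outer_box_le _ _).
apply: le_lebesgue_outer => x /= bx i; have := bx i; rewrite mul_diag_mx !mxE.
case: (ltrgtP 0 (d 0 i)) (dn0 i) => [dp|dm|<-] d0.
- by rewrite ler_pdivrMr// ler_pdivlMr// ![x i 0 * _]mulrC.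
- by rewrite ler_ndivrMr// ler_ndivlMr// ![x i 0 * _]mulrC andbC.
- by [].
Qed.

Definition transvection {n} (i j : 'I_n) (c : R) : 'M[R]_n :=
  1%:M + c *: delta_mx i j.

Lemma transvectionE {n} (i j : 'I_n) c (x : 'cV[R]_n) k :
  (transvection i j c *m x) k 0 = x k 0 + (k == i)%:R * (c * x j 0).
Proof.
rewrite mulmxDl mul1mx mxE -scalemxAl mxE; congr (_ + _).
rewrite mulrCA; congr (_ * _); rewrite mxE (bigD1 j)//= big1 => [|l /negbTE lj].
  by rewrite mxE eqxx andbT addr0.
by rewrite mxE lj andbF mul0r.
Qed.

Lemma uniform_partition_cover N (a d x : R) : a <= x <= a + N.+1%:R * d ->
  exists2 m, (m < N.+1)%N & a + m%:R * d <= x <= a + m.+1%:R * d.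
Proof.
elim: N => [|N IH] /andP[ax xb]; first by exists 0%N => //; rewrite mul0r addr0 ax.
have [xN|Nx] := leP x (a + N.+1%:R * d).
  have [|m mN mx] := IH; first by rewrite ax.
  by exists m => //; exact: ltnW.
by exists N.+1 => //; rewrite ltW.
Qed.

(* The preimage of a box is cut into N slabs orthogonal to the j-th axis; each
   slab fits in a box whose i-th side exceeds that of the original box only by
   O(1/N), so the total volume tends to that of the box. *)
Lemma outer_nonincreasing_transvection {n} (i j : 'I_n) c : i != j ->
  outer_nonincreasing (transvection i j c).
Proof.
case: n i j => [[]//|n] i j ij; apply: outer_nonincreasing_box => a b ab.
pose w := b j 0 - a j 0.
pose P := \prod_(k | (k != j) && (k != i)) (b k 0 - a k 0).
have w0 : 0 <= w by rewrite subr_ge0.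
have P0 : 0 <= P by apply: prodr_ge0 => k _; rewrite subr_ge0.
have volE : box_vol a b = w * ((b i 0 - a i 0) * P).
  by rewrite box_volE// (bigD1 j)//= (bigD1 i).
(* The slabs together exceed the volume of the box by exactly K / (N + 1), and the choice of [N]
   below makes this at most e. *)
pose K := 2 * `|c| * w ^+ 2 * P.
have K0 : 0 <= K by rewrite !mulr_ge0// sqr_ge0.
apply/lee_addgt0Pr => e e0.
pose N := Num.bound (K / e).
pose d := w / N.+1%:R.
have d0 : 0 <= d by rewrite divr_ge0.
have Nd : N.+1%:R * d = w by rewrite mulrC divfK// pnatr_eq0.
(* On the m-th slab, x_j exceeds its left end by at most d, so c * x_j varies by at most |c| d.
   Widening the i-th side by |c| d at both ends therefore catches the whole slab. *)
pose lo m : 'cV[R]_n.+1 := \col_k (if k == j then a j 0 + m%:R * d else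
  if k == i then a i 0 - c * (a j 0 + m%:R * d) - `|c| * d else a k 0).
pose hi m : 'cV[R]_n.+1 := \col_k (if k == j then a j 0 + m.+1%:R * d else
  if k == i then b i 0 - c * (a j 0 + m%:R * d) + `|c| * d else b k 0).
have lenj m : hi m j 0 - lo m j 0 = d.
  by rewrite !mxE eqxx -natr1; ring.
have leni m : hi m i 0 - lo m i 0 = b i 0 - a i 0 + 2 * `|c| * d.
  by rewrite !mxE (negbTE ij) eqxx; ring.
have lenk m k : k != j -> k != i -> hi m k 0 - lo m k 0 = b k 0 - a k 0.
  by move=> /negbTE kj /negbTE ki; rewrite !mxE kj ki.
have lohi m k : lo m k 0 <= hi m k 0.
  rewrite -subr_ge0; have [->|kj] := eqVneq k j; first by rewrite lenj.
  have [->|ki] := eqVneq k i; last by rewrite lenk// subr_ge0.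
  by rewrite leni addr_ge0 ?subr_ge0// !mulr_ge0.
have volm m : box_vol (lo m) (hi m) = d * ((b i 0 - a i 0 + 2 * `|c| * d) * P).
  rewrite box_volE// (bigD1 j)//= (bigD1 i)//= lenj leni; congr (_ * (_ * _)).
  by apply: eq_bigr => k /andP[kj ki]; exact: lenk.
apply: le_trans (@lebesgue_outer_finite_cover _ _ N.+1 (fun m => (lo m, hi m)) _) _.
  move=> x /= bx.
  have xj : a j 0 <= x j 0 <= b j 0.
    by have := bx j; rewrite transvectionE eq_sym (negbTE ij) mul0r addr0.
  have [|m mN mx] := @uniform_partition_cover N (a j 0) d (x j 0).
    by rewrite Nd /w subrKC.
  exists m => // k; rewrite !mxE.
  have [->//|kj] := eqVneq k j.
  have := bx k; rewrite transvectionE.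
  have [->|ki] := eqVneq k i; last by rewrite mul0r addr0.
  rewrite mul1r => /andP[axi xib].
  have /ler_normlP[cl cr] : `|c * (x j 0 - (a j 0 + m%:R * d))| <= `|c| * d.
    rewrite normrM ler_wpM2l// ger0_norm; last by rewrite subr_ge0; case/andP: mx.
    by case/andP: mx => _; rewrite -natr1; lra.
  by apply/andP; split; lra.
rewrite (eq_bigr _ (fun (m : 'I_N.+1) _ => volm m)) sumr_const card_ord -EFinD lee_fin.
rewrite volE -[leLHS]mulr_natl [leLHS]mulrA Nd.
have -> : w * ((b i 0 - a i 0 + 2 * `|c| * d) * P) =
    w * ((b i 0 - a i 0) * P) + K / N.+1%:R by rewrite /K /d; ring.
rewrite lerD2l ler_pdivrMr ?ltr0n// -ler_pdivrMl// [leLHS]mulrC.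
have /archi_boundP/ltW/le_trans : 0 <= K / e by rewrite divr_ge0// ltW.
by apply; rewrite ler_nat.
Qed.

End linear_maps.

(** * From elementary matrices to all matrices of determinant 1 or -1 *)

Section generation.
Context {R : realType}.

(* Carrying the transpose along reduces upper triangular matrices to lower ones. *)
Definition outer_binonincreasing {n} (T : 'M[R]_n) :=
  outer_nonincreasing T /\ outer_nonincreasing T^T.

Lemma outer_binonincreasing_mul {n} (S T : 'M[R]_n) :
  outer_binonincreasing S -> outer_binonincreasing T ->
  outer_binonincreasing (S *m T).
Proof.
move=> [S1 S2] [T1 T2]; split; first exact: outer_nonincreasing_mul.
by rewrite trmx_mul; exact: outer_nonincreasing_mul.
Qed.

Lemma outer_binonincreasing1 {n} : outer_binonincreasing (1%:M : 'M[R]_n).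
Proof. by rewrite /outer_binonincreasing trmx1; split; exact: outer_nonincreasing1. Qed.

Lemma outer_binonincreasing_transvection {n} (i j : 'I_n) c : i != j ->
  outer_binonincreasing (transvection i j c : 'M[R]_n).
Proof.
move=> ij; split; first exact: outer_nonincreasing_transvection.
rewrite linearD/= linearZ/= trmx1 trmx_delta.
by apply: outer_nonincreasing_transvection; rewrite eq_sym.
Qed.

(** The identity with the row vector c added to its k-th row. *)
Definition row_shear {n} (k : 'I_n) (c : 'rV[R]_n) : 'M[R]_n :=
  1%:M + delta_mx k 0 *m c.

(** The cross term of the product contains the scalar c_k, which vanishes. *)
Lemma row_shearD {n} (k : 'I_n) (c d : 'rV[R]_n) : c 0 k = 0 ->
  row_shear k (c + d) = row_shear k c *m row_shear k d.
Proof.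
move=> ck; rewrite /row_shear mulmxDl mul1mx mulmxDr mulmx1 mulmxA.
have -> : delta_mx k 0 *m c *m delta_mx k 0 = 0 :> 'cV[R]_n.
  rewrite -mulmxA -colE [col k c]mx11_scalar mxE ck.
  by rewrite (_ : 0%:M = 0) ?mulmx0//; exact: raddf0.
by rewrite mul0mx addr0 mulmxDr -addrA [_ *m d + _]addrC.
Qed.

Lemma outer_binonincreasing_row_shear {n} (k : 'I_n) (c : 'rV[R]_n) :
  c 0 k = 0 -> outer_binonincreasing (row_shear k c).
Proof.
move=> ck; rewrite [c]row_sum_delta (bigD1 k)//= ck scale0r add0r.
(* The vanishing of the k-th entry is carried along the sum, since splitting the shear of a sum
   requires it; each single summand gives a transvection. *)
pose P (u : 'rV[R]_n) := u 0 k = 0 /\ outer_binonincreasing (row_shear k u).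
suff [] : P (\sum_(i < n | i != k) c 0 i *: delta_mx 0 i) by [].
apply: (big_ind P) => [|u v [uk Pu] [vk Pv]|j jk].
- by split; rewrite ?mxE// /row_shear mulmx0 addr0; exact: outer_binonincreasing1.
- split; first by rewrite mxE uk vk addr0.
  by rewrite row_shearD//; exact: outer_binonincreasing_mul.
- split; first by rewrite !mxE eqxx eq_sym (negbTE jk) mulr0.
  rewrite /row_shear -scalemxAr mul_delta_mx.
  by apply: outer_binonincreasing_transvection; rewrite eq_sym.
Qed.

(** Induction on a bound k beyond which all rows are those of the identity: the last remaining row
    is split off as a row shear on the right. *)
Lemma outer_binonincreasing_lower_unitriangular {n} (L : 'M[R]_n) :
  (forall i j : 'I_n, (i <= j)%N -> L i j = (i == j)%:R) -> outer_binonincreasing L.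
Proof.
move=> Llow.
suff peel_rows k (M : 'M[R]_n) :
    (forall i j : 'I_n, (i <= j)%N -> M i j = (i == j)%:R) ->
    (forall i j : 'I_n, (k <= i)%N -> M i j = (i == j)%:R) ->
    outer_binonincreasing M.
  by apply: (peel_rows n) => // i j; rewrite leqNgt ltn_ord.
elim: k M {L Llow} => [|k IH] M Mlow Mid.
  rewrite (_ : M = 1%:M); first exact: outer_binonincreasing1.
  by apply/matrixP => i j; rewrite Mid// mxE.
have [kn|nk] := ltnP k n; last first.
  by apply: IH => // i j ki; have := leq_ltn_trans (leq_trans nk ki) (ltn_ord i); rewrite ltnn.
pose K := Ordinal kn.
pose M' : 'M[R]_n := \matrix_(i, j) (if i == K then (i == j)%:R else M i j).
pose c := row K M - delta_mx 0 K.
(* Column K of [M'] is that of the identity: above the diagonal by triangularity, below it because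
   those rows are already trivial. Hence multiplying [M'] by the shear alters row K only. *)
have M'K : M' *m delta_mx K 0 = delta_mx K 0 :> 'cV[R]_n.
  rewrite -colE; apply/colP => i; rewrite !mxE andbT.
  case: (eqVneq i K) => // iK; case: (ltngtP i K) => [iltK|Klti|/val_inj iEK].
  - by rewrite Mlow ?(ltnW iltK)// (negbTE iK).
  - by rewrite Mid// (negbTE iK).
  - by rewrite iEK eqxx in iK.
have -> : M = M' *m row_shear K c.
  rewrite /row_shear mulmxDr mulmx1 mulmxA M'K; apply/matrixP => i j.
  rewrite !mxE big_ord1 !mxE !andbT; case: eqVneq => [->|iK].
    by rewrite mul1r [K == j]eq_sym subrKC.
  by rewrite mul0r addr0.
apply: outer_binonincreasing_mul; last first.
  apply: outer_binonincreasing_row_shear.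
  by rewrite !mxE Mlow// !eqxx subrr.
apply: IH => i j ij; rewrite mxE; case: eqVneq => // iK; first exact: Mlow.
apply: Mid; rewrite ltn_neqAle ij andbT.
by apply/eqP => kE; move/eqP: iK; apply; apply: val_inj.
Qed.

(** In P T = L U the factors P and L have determinant of absolute value 1, hence so has U, and its
    diagonal has no zero. Thus U = D V with D the diagonal part of U and V upper unitriangular; V is
    handled through its transpose. *)
Lemma outer_nonincreasing_det1 {n} (T : 'M[R]_n) :
  `|\det T| = 1 -> outer_nonincreasing T.
Proof.
case: n T => [|n] T detT; first exact: outer_nonincreasing_dim0.
have := cormen_lup_correct T; have := cormen_lup_perm T.
have := cormen_lup_detL T; have := @cormen_lup_lower _ _ T.
have := @cormen_lup_upper _ _ T.
case: cormen_lup => [[P L] U]/= Uup Llow detL /is_perm_mxP[s ->] PT.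
have TE : T = perm_mx s^-1 *m (L *m U).
  by rewrite [L *m U](_ : _ = L * U)// -PT mulmxA -perm_mxM mulVg perm_mx1 mul1mx.
have detU : `|\det U| = 1.
  have := congr1 (fun A => `|\det A|) PT.
  by rewrite !det_mulmx detL det_perm normrM normrX normrN1 expr1n !mul1r detT.
have detUE : \det U = \prod_i U i i.
  rewrite -det_tr det_trig; first by apply: eq_bigr => i _; rewrite mxE.
  by apply/is_trig_mxP => i j ij; rewrite mxE Uup.
have Un0 i : U i i != 0.
  apply/eqP => Ui; move: detU; rewrite detUE (bigD1 i)//= Ui mul0r normr0 => /esym/eqP.
  by rewrite oner_eq0.
pose D := diag_mx (\row_i U i i).
pose V : 'M[R]_n.+1 := \matrix_(i, j) (U i j / U i i).
have UE : U = D *m V.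
  by apply/matrixP => i j; rewrite mul_diag_mx !mxE mulrCA divff ?mulr1.
rewrite TE UE; apply: outer_nonincreasing_mul; first exact: outer_nonincreasing_perm.
apply: outer_nonincreasing_mul.
  by have [] := @outer_binonincreasing_lower_unitriangular _ L Llow.
apply: outer_nonincreasing_mul.
  apply: outer_nonincreasing_diag; rewrite det_diag -[RHS]detU detUE.
  by congr Num.norm; apply: eq_bigr => i _; rewrite mxE.
suff [_] : outer_binonincreasing V^T by rewrite trmxK.
apply: outer_binonincreasing_lower_unitriangular => i j ij; rewrite !mxE.
have [->|jNi] := eqVneq i j; first by rewrite divff.
by rewrite Uup ?mul0r// ltn_neqAle ij andbT.
Qed.

Lemma unitmx_det1 {n} (T : 'M[R]_n) : `|\det T| = 1 -> T \in unitmx.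
Proof. by move=> detT; rewrite unitmxE unitfE -normr_eq0 detT oner_eq0. Qed.

Lemma det1_invmx {n} (T : 'M[R]_n) : `|\det T| = 1 -> `|\det (invmx T)| = 1.
Proof. by move=> detT; rewrite det_inv normfV detT invr1. Qed.

(** The inequality for T and the inequality for its inverse give the two directions. *)
Lemma lebesgue_outer_preimage {n} (T : 'M[R]_n) (A : set 'cV[R]_n) :
  `|\det T| = 1 -> lebesgue_outer [set x | A (T *m x)] = lebesgue_outer A.
Proof.
move=> detT; apply/eqP; rewrite eq_le outer_nonincreasing_det1//=.
have Tu := unitmx_det1 _ detT; have detV := det1_invmx _ detT.
have := outer_nonincreasing_det1 _ detV [set x | A (T *m x)].
by apply: le_trans; apply: le_lebesgue_outer => x /=; rewrite mulKVmx.
Qed.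

End generation.

(** * Invariance of measurability and of integrals *)

Section integrals.
Context {R : realType} {n : nat}.
Implicit Types (T : 'M[R]_n) (D : set 'cV[R]_n) (f : 'cV[R]_n -> R).

(** Testing the preimage of D against B amounts to testing D against the image of B, written as a
    preimage under the inverse of T. *)
Lemma lebesgue_measurable_set_preimage T D : `|\det T| = 1 ->
  lebesgue_measurable_set D -> lebesgue_measurable_set [set x | D (T *m x)].
Proof.
move=> detT mD B.
have Tu := unitmx_det1 _ detT; have detV := det1_invmx _ detT.
have := mD [set y | B (invmx T *m y)]; rewrite lebesgue_outer_preimage// => ->.
rewrite -(lebesgue_outer_preimage _ (_ `&` D) detT).
rewrite -(lebesgue_outer_preimage _ (_ `&` ~` D) detT).
by congr (_ + _)%E; congr lebesgue_outer; apply/seteqP; split => x /=; rewrite mulKmx.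
Qed.

Lemma lebesgue_measurable_fun_preimage T D f : `|\det T| = 1 ->
  lebesgue_measurable_fun D f ->
  lebesgue_measurable_fun [set x | D (T *m x)] (fun x => f (T *m x)).
Proof.
by move=> detT mf t; have := lebesgue_measurable_set_preimage _ _ detT (mf t).
Qed.

(** Superlevel sets of the composition are preimages of superlevel sets of f, so the layer-cake
    integrands agree at every t. *)
Lemma integral_nonneg_preimage T D f : `|\det T| = 1 ->
  integral_nonneg [set x | D (T *m x)] (fun x => f (T *m x)) = integral_nonneg D f.
Proof.
move=> detT; apply: eq_integral => t _.
exact: (lebesgue_outer_preimage _ (D `&` [set x | t < f x]) detT).
Qed.

Lemma integral_Rn_preimage T D f : `|\det T| = 1 ->
  integral_Rn [set x | D (T *m x)] (fun x => f (T *m x)) = integral_Rn D f.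
Proof.
move=> detT; rewrite /integral_Rn.
rewrite (integral_nonneg_preimage _ _ (fun x => Num.max (f x) 0) detT).
by rewrite (integral_nonneg_preimage _ _ (fun x => Num.max (- f x) 0) detT).
Qed.

End integrals.

(** * Inner product, Euclidean norm and boundedness of linear maps *)

Section euclidean.
Context {R : realType} {n : nat}.
Implicit Types (x y u v w : 'cV[R]_n) (T : 'M[R]_n).

Lemma dotvE x y : dotv x y = (x^T *m y) 0 0.
Proof. by rewrite mxE; apply: eq_bigr => i _; rewrite mxE. Qed.

Lemma dotv_mulmxl T x y : dotv (T *m x) y = dotv x (T^T *m y).
Proof. by rewrite !dotvE trmx_mul mulmxA. Qed.

Lemma dotv_mulmxr T x y : dotv x (T *m y) = dotv (T^T *m x) y.
Proof. by rewrite dotv_mulmxl trmxK. Qed.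

Lemma dotvBl u v w : dotv (u - v) w = dotv u w - dotv v w.
Proof. by rewrite !dotvE linearB/= mulmxBl !mxE. Qed.

Lemma dotvZr c u v : dotv u (c *: v) = c * dotv u v.
Proof. by rewrite !dotvE -scalemxAr mxE. Qed.

Lemma dotvZl c u v : dotv (c *: u) v = c * dotv u v.
Proof. by rewrite !dotvE linearZ/= -scalemxAl mxE. Qed.

Lemma dotvv_ge0 x : 0 <= dotv x x.
Proof. by apply: sumr_ge0 => i _; rewrite -expr2 sqr_ge0. Qed.

Lemma enorm_ge0 x : 0 <= enorm x.
Proof. exact: sqrtr_ge0. Qed.

Lemma enorm_sqr x : enorm x ^+ 2 = dotv x x.
Proof. by rewrite sqr_sqrtr// dotvv_ge0. Qed.

Lemma enorm_eq0 x : enorm x = 0 -> x = 0.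
Proof.
move=> x0; have /eqP : dotv x x = 0 by rewrite -enorm_sqr x0 expr0n.
rewrite psumr_eq0 => [/allP x2|i _]; last by rewrite -expr2 sqr_ge0.
apply/colP => i; have := x2 i (mem_index_enum _).
by rewrite mulf_eq0 orbb mxE => /eqP.
Qed.

Lemma enormZ c x : 0 <= c -> enorm (c *: x) = c * enorm x.
Proof.
move=> c0; rewrite /enorm dotvZl dotvZr mulrA -expr2 sqrtrM ?sqr_ge0//.
by rewrite sqrtr_sqr ger0_norm.
Qed.

Lemma coord_le_enorm x i : `|x i 0| <= enorm x.
Proof.
rewrite -sqrtr_sqr ler_sqrt ?dotvv_ge0// /dotv (bigD1 i)//= -expr2 lerDl.
by apply: sumr_ge0 => k _; rewrite -expr2 sqr_ge0.
Qed.

Lemma enorm_le_sum x : enorm x <= \sum_i `|x i 0|.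
Proof.
have s0 : 0 <= \sum_i `|x i 0| by apply: sumr_ge0.
rewrite -[leRHS]ger0_norm// -sqrtr_sqr ler_sqrt ?sqr_ge0//.
rewrite expr2 mulr_suml; apply: ler_sum => i _.
rewrite -expr2 -real_normK ?num_real// expr2 ler_wpM2l//.
by rewrite (bigD1 i)//= lerDl; apply: sumr_ge0.
Qed.

Lemma enorm_mulmx_bound T : exists2 M, 0 < M & forall x, enorm (T *m x) <= M * enorm x.
Proof.
pose M := \sum_i \sum_j `|T i j|.
have M0 : 0 <= M by apply: sumr_ge0 => i _; apply: sumr_ge0.
(* Adding 1 keeps the bound positive even for T = 0, so that it can be divided by. *)
exists (M + 1) => [|x]; first by rewrite ltr_wpDl.
apply: (@le_trans _ _ (M * enorm x)); last by rewrite ler_wpM2r ?enorm_ge0// lerDl.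
apply: le_trans (enorm_le_sum _) _; rewrite mulr_suml; apply: ler_sum => i _.
rewrite mxE mulr_suml; apply: le_trans (ler_norm_sum _ _ _) _.
by apply: ler_sum => j _; rewrite normrM ler_wpM2l// coord_le_enorm.
Qed.

End euclidean.

(** * Gradient, Alexandrov Hessian and conjugate under a linear substitution *)

Section change_of_variables.
Context {R : realType} {n : nat}.
Implicit Types (psi : 'cV[R]_n -> \bar R) (T : 'M[R]_n) (x v : 'cV[R]_n).

Lemma compT_invmx psi T : T \in unitmx -> compT (compT psi T) (invmx T) = psi.
Proof.
by move=> Tu; apply/funext => x; rewrite /compT mulKVmx.
Qed.

Lemma mulmx_ball T x : exists2 M, 0 < M & forall (r : R) y,
  enorm (y - x) < r / M -> enorm (T *m y - T *m x) < r.
Proof.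
have [M M0 TM] := enorm_mulmx_bound T; exists M => // r y.
rewrite ltr_pdivlMr// mulrC -mulmxBr => /(le_lt_trans (TM _)); exact.
Qed.

Lemma finite_near_compT psi T x :
  finite_near psi (T *m x) -> finite_near (compT psi T) x.
Proof.
move=> [r [r0 fr]]; have [M M0 TM] := mulmx_ball T x.
by exists (r / M); split => [|y /TM/fr//]; rewrite divr_gt0.
Qed.

Lemma has_gradient_compT psi T x v :
  has_gradient psi (T *m x) v -> has_gradient (compT psi T) x (T^T *m v).
Proof.
move=> [/finite_near_compT fin gr]; split => // e e0.
have [M M0 TM] := enorm_mulmx_bound T.
have [|d [d0 dP]] := gr (e / M); first by rewrite divr_gt0.
exists (d / M); split => [|y yx]; first by rewrite divr_gt0.
have TyxM : enorm (T *m y - T *m x) <= M * enorm (y - x) by rewrite -mulmxBr.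
have /dP : enorm (T *m y - T *m x) < d.
  by apply: le_lt_trans TyxM _; rewrite mulrC -ltr_pdivlMr.
rewrite -mulmxBr dotv_mulmxr => /le_trans; apply.
by rewrite -mulrA ler_pM2l// ler_pdivrMl// mulmxBr.
Qed.

Lemma alexandrov_taylor_compT psi T x v A :
  alexandrov_taylor psi (T *m x) v A ->
  alexandrov_taylor (compT psi T) x (T^T *m v) (T^T *m A *m T).
Proof.
move=> [/finite_near_compT fin gr]; split => // e e0.
have [M M0 TM] := enorm_mulmx_bound T.
(* The error is quadratic, so the operator bound M enters squared. *)
have [|d [d0 dP]] := gr (e / M ^+ 2); first by rewrite divr_gt0// exprn_gt0.
exists (d / M); split => [|y yx]; first by rewrite divr_gt0.
have TyxM : enorm (T *m y - T *m x) <= M * enorm (y - x) by rewrite -mulmxBr.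
have /dP : enorm (T *m y - T *m x) < d.
  by apply: le_lt_trans TyxM _; rewrite mulrC -ltr_pdivlMr.
rewrite -mulmxBr dotv_mulmxr [dotv (A *m _) _]dotv_mulmxr !mulmxA => /le_trans; apply.
rewrite -mulrA ler_pM2l// ler_pdivrMl ?exprn_gt0// -exprMn.
by rewrite ler_pXn2r// ?nnegrE ?enorm_ge0// mulr_ge0 ?enorm_ge0// ltW.
Qed.

(** Both expansions are compared along u = v - w: with tolerance |u| / 4 in each, they give t |u|^2
    <= t |u|^2 / 2, which is impossible for u nonzero. *)
Lemma has_gradient_unique psi x v w :
  has_gradient psi x v -> has_gradient psi x w -> v = w.
Proof.
move=> [_ gv] [_ gw]; apply/eqP; rewrite -subr_eq0; apply/eqP.
set u := v - w; apply: enorm_eq0; apply/eqP; rewrite eq_le enorm_ge0 andbT.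
rewrite leNgt; apply/negP => u0.
pose e := enorm u / 4.
have e0 : 0 < e by rewrite divr_gt0.
have [d1 [d10 P1]] := gv e e0; have [d2 [d20 P2]] := gw e e0.
(* The displacement t u has length min(d1, d2) / 2, inside both neighbourhoods. *)
pose t := Num.min d1 d2 / (2 * enorm u).
have m0 : 0 < Num.min d1 d2 by rewrite lt_min d10.
have t0 : 0 < t by rewrite divr_gt0// mulr_gt0.
have tu : enorm (x + t *: u - x) = t * enorm u.
  by rewrite addrAC subrr add0r enormZ// ltW.
have tum : t * enorm u < Num.min d1 d2.
  have -> : t * enorm u = Num.min d1 d2 / 2.
    by rewrite /t; field; rewrite gt_eqF.
  by rewrite ltr_pdivrMr// ltr_pMr// ltr1n.
move: tum; rewrite lt_min => /andP[tu1 tu2].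
have {P1} := P1 (x + t *: u); have {P2} := P2 (x + t *: u).
rewrite tu => /(_ tu2) + /(_ tu1).
rewrite ![x + _ - _]addrAC !subrr !add0r !dotvZr.
set q := fine _ - _ => /ler_normlP[_ lw] /ler_normlP[lv _].
have : t * dotv u u <= t * (enorm u * (enorm u / 2)).
  rewrite dotvBl mulrBr; move: lv lw; rewrite /e -/u.
  by set a := t * dotv v u; set b := t * dotv w u; lra.
rewrite ler_pM2l// -enorm_sqr expr2 ler_pM2l//.
by move=> ?; lra.
Qed.

Lemma gradE psi x v : has_gradient psi x v -> grad psi x = v.
Proof.
move=> gv; apply: (has_gradient_unique psi x) (gv).
exact: (@xgetI _ 0 [set v | has_gradient psi x v] v).
Qed.

Lemma grad_compT psi T x : T \in unitmx ->
  grad (compT psi T) x = T^T *m grad psi (T *m x).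
Proof.
move=> Tu; have [[v gv]|nog] := pselect (exists v, has_gradient psi (T *m x) v).
  by rewrite (gradE _ _ _ gv); apply: gradE; exact: has_gradient_compT.
(* Without a gradient of psi at T x there is none of psi o T at x, by composing with the inverse of
   T; both sides are then the default value 0. *)
rewrite /grad !xgetPN ?mulmx0// => v gv; apply: nog; first by exists v.
exists ((invmx T)^T *m v).
have := has_gradient_compT (compT psi T) (invmx T) (T *m x) v.
by rewrite compT_invmx// mulKmx//; exact.
Qed.

Lemma Xset_compT_sub psi T x : T \in unitmx ->
  Xset psi (T *m x) -> Xset (compT psi T) x.
Proof.
move=> Tu [fin [A [[AT [v Av]] Au]]]; split=> //.
exists (T^T *m A *m T); split; last by rewrite !unitmx_mul unitmx_tr Tu Au.
split; first by rewrite !trmx_mul trmxK AT mulmxA.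
by exists (T^T *m v); exact: alexandrov_taylor_compT.
Qed.

(** The Hessian A becomes T^T A T, which is invertible exactly when A is. The converse inclusion is
    the direct one for psi o T and the inverse of T. *)
Lemma Xset_compT psi T : T \in unitmx ->
  Xset (compT psi T) = [set x | Xset psi (T *m x)].
Proof.
move=> Tu; apply/seteqP; split => x /=; last exact: Xset_compT_sub.
have := Xset_compT_sub (compT psi T) (invmx T) (T *m x).
by rewrite unitmx_inv compT_invmx// mulKmx//; apply.
Qed.

(** The substitution of T x for x reindexes the supremum, and T moves across the pairing as its
    inverse transpose. *)
Lemma legendre_compT psi T : T \in unitmx ->
  legendre (compT psi T) = compT (legendre psi) (invmx T)^T.
Proof.
move=> Tu; apply/funext => y; rewrite /legendre /compT.
congr ereal_sup; apply/seteqP; split => _ [x _ <-].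
  by exists (T *m x) => //; rewrite dotv_mulmxr trmxK mulKmx.
by exists (invmx T *m x) => //; rewrite mulKVmx// dotv_mulmxr trmxK.
Qed.

Lemma econvex_compT psi T : econvex psi -> econvex (compT psi T).
Proof.
move=> cvx x y t t01; rewrite /compT mulmxDr -!scalemxAr; exact: cvx.
Qed.

End change_of_variables.

(** * Transport of admissible densities and invariance of the Orlicz functionals *)

Section orlicz.
Context {R : realType} {n : nat}.
Implicit Types (psi : 'cV[R]_n -> \bar R) (T : 'M[R]_n) (g : 'cV[R]_n -> R).

(** Densities live on the side of the conjugate, hence the inverse transpose. *)
Definition dual_comp g T : 'cV[R]_n -> R := fun y => g ((invmx T)^T *m y).

Lemma Xset_legendre_compT psi T : T \in unitmx ->
  Xset (legendre (compT psi T)) = [set y | Xset (legendre psi) ((invmx T)^T *m y)].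
Proof.
by move=> Tu; rewrite legendre_compT// Xset_compT// unitmx_tr unitmx_inv.
Qed.

Lemma Iint_compT psi T g : `|\det T| = 1 ->
  Iint (dual_comp g T) (compT psi T) = Iint g psi.
Proof.
move=> detT; rewrite /Iint Xset_legendre_compT ?unitmx_det1//.
by apply: integral_Rn_preimage; rewrite det_tr det1_invmx.
Qed.

Lemma Fplus_compT psi T g : `|\det T| = 1 ->
  Fplus psi g -> Fplus (compT psi T) (dual_comp g T).
Proof.
move=> detT [mg g0 Ig]; split; last by rewrite Iint_compT.
- rewrite Xset_legendre_compT ?unitmx_det1//.
  by apply: lebesgue_measurable_fun_preimage; rewrite ?det_tr ?det1_invmx.
- by rewrite Xset_legendre_compT ?unitmx_det1// => y; exact: g0.
Qed.

Lemma Lplus_compT psi T g : `|\det T| = 1 ->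
  Lplus psi g -> Lplus (compT psi T) (dual_comp g T).
Proof.
move=> detT [Fg [phi [phiN phic gE]]]; split; first exact: Fplus_compT.
exists (compT phi (invmx T)^T); split; first by move=> x; exact: phiN.
- exact: econvex_compT.
- by rewrite Xset_legendre_compT ?unitmx_det1// => y; exact: gE.
Qed.

Lemma normalize_compT psi T g : `|\det T| = 1 ->
  normalize (compT psi T) (dual_comp g T) = dual_comp (normalize psi g) T.
Proof.
by move=> detT; apply/funext => y; rewrite /normalize Iint_compT.
Qed.

(** After the change of variables by T the integrands agree pointwise: the inverse transpose in
    [dual_comp] cancels the T^T in the gradient of psi o T, and the pairing of x with T^T p is that
    of T x with p. *)
Lemma Vfun_compT h F1 F2 psi T g : `|\det T| = 1 ->
  Vfun h F1 F2 (compT psi T) (dual_comp g T) = Vfun h F1 F2 psi g.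
Proof.
move=> detT; have Tu := unitmx_det1 _ detT.
rewrite /Vfun Xset_compT// -[RHS](integral_Rn_preimage T _ _ detT).
apply: (congr1 (integral_Rn _)); apply/funext => x.
have gradT : (invmx T)^T *m grad (compT psi T) x = grad psi (T *m x).
  by rewrite grad_compT// mulmxA -trmx_mul mulmxV// trmx1 mul1mx.
have dotT : dotv x (grad (compT psi T) x) = dotv (T *m x) (grad psi (T *m x)).
  by rewrite grad_compT// [RHS]dotv_mulmxl.
by rewrite /dual_comp gradT dotT.
Qed.

(* [G] stands for the class of admissible densities; it is enough that it be
   transported one way, since psi is again (psi o T) o T^-1. *)
Lemma Vfun_range_compT (G : ('cV[R]_n -> \bar R) -> set ('cV[R]_n -> R))
    h F1 F2 psi T :
  (forall psi T g, `|\det T| = 1 -> G psi g -> G (compT psi T) (dual_comp g T)) ->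
  `|\det T| = 1 ->
  [set Vfun h F1 F2 (compT psi T) (normalize (compT psi T) g) | g in G (compT psi T)]
  = [set Vfun h F1 F2 psi (normalize psi g) | g in G psi].
Proof.
move=> Gtransport detT.
have transport psi' S : `|\det S| = 1 ->
    [set Vfun h F1 F2 psi' (normalize psi' g) | g in G psi'] `<=`
    [set Vfun h F1 F2 (compT psi' S) (normalize (compT psi' S) g)
    | g in G (compT psi' S)].
  move=> detS _ [g Gg <-]; exists (dual_comp g S); first exact: Gtransport.
  by rewrite normalize_compT// Vfun_compT.
apply/seteqP; split; last exact: transport.
have := transport (compT psi T) (invmx T) (det1_invmx _ detT).
by rewrite compT_invmx// unitmx_det1.
Qed.

Lemma as_orlicz_inf_compT h F1 F2 psi T : `|\det T| = 1 ->
  as_orlicz_inf h F1 F2 (compT psi T) = as_orlicz_inf h F1 F2 psi.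
Proof.
move=> detT; apply: (congr1 (@ereal_inf R)).
exact: (Vfun_range_compT (@Fplus R n) _ _ _ _ _ Fplus_compT detT).
Qed.

Lemma as_orlicz_sup_compT h F1 F2 psi T : `|\det T| = 1 ->
  as_orlicz_sup h F1 F2 (compT psi T) = as_orlicz_sup h F1 F2 psi.
Proof.
move=> detT; apply: (congr1 (@ereal_sup R)).
exact: (Vfun_range_compT (@Fplus R n) _ _ _ _ _ Fplus_compT detT).
Qed.

Lemma G_orlicz_inf_compT h F1 F2 psi T : `|\det T| = 1 ->
  G_orlicz_inf h F1 F2 (compT psi T) = G_orlicz_inf h F1 F2 psi.
Proof.
move=> detT; apply: (congr1 (@ereal_inf R)).
exact: (Vfun_range_compT (@Lplus R n) _ _ _ _ _ Lplus_compT detT).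
Qed.

Lemma G_orlicz_sup_compT h F1 F2 psi T : `|\det T| = 1 ->
  G_orlicz_sup h F1 F2 (compT psi T) = G_orlicz_sup h F1 F2 psi.
Proof.
move=> detT; apply: (congr1 (@ereal_sup R)).
exact: (Vfun_range_compT (@Lplus R n) _ _ _ _ _ Lplus_compT detT).
Qed.

End orlicz.

Theorem theorem2p2 (R : realType) (n : nat) (psi : 'cV[R]_n -> \bar R)
    (F1 F2 h : R -> R) (T : 'M[R]_n) :
  class_C psi ->
  measurable_fun [set: R] F1 -> measurable_fun [set: R] F2 ->
  (forall t, 0 < F1 t) -> (forall t, 0 < F2 t) ->
  pos_continuous h ->
  (\det T = 1 \/ \det T = -1) ->
  [/\ PhiClass h ->
        as_orlicz_inf h F1 F2 (compT psi T) = as_orlicz_inf h F1 F2 psi /\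
        G_orlicz_inf h F1 F2 (compT psi T) = G_orlicz_inf h F1 F2 psi,
      PsiClass h ->
        as_orlicz_sup h F1 F2 (compT psi T) = as_orlicz_sup h F1 F2 psi /\
        G_orlicz_sup h F1 F2 (compT psi T) = G_orlicz_sup h F1 F2 psi,
      PhiClass h ->
        as_orlicz_inf h (@expneg R) (@expneg R) (compT psi T)
          = as_orlicz_inf h (@expneg R) (@expneg R) psi /\
        G_orlicz_inf h (@expneg R) (@expneg R) (compT psi T)
          = G_orlicz_inf h (@expneg R) (@expneg R) psi &
      PsiClass h ->
        as_orlicz_sup h (@expneg R) (@expneg R) (compT psi T)
          = as_orlicz_sup h (@expneg R) (@expneg R) psi /\
        G_orlicz_sup h (@expneg R) (@expneg R) (compT psi T)
          = G_orlicz_sup h (@expneg R) (@expneg R) psi].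
Proof.
move=> _ _ _ _ _ _ detT.
have {}detT : `|\det T| = 1 by case: detT => ->; rewrite ?normrN1 ?normr1.
by split=> _; split; rewrite ?as_orlicz_inf_compT ?as_orlicz_sup_compT
  ?G_orlicz_inf_compT ?G_orlicz_sup_compT.
Qed.
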